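(* Let $\mathcal{C}$ be an equational class of algebras, $A$ and $B$ algebras from $\mathcal{C}$ and $f:A\to B$ a morphism in $\mathcal{C}$. (1) If $\mathrm{Max}(B)=\mathrm{Con}_2(B)$ and $(f^* )^{-1}(\{\nabla_A\})=\{\nabla_B\}$, then $f$ is Max-admissible. (2) If $\mathcal{C}$ is congruence-modular, $\mathrm{Spec}(B)=\mathrm{Max}(B)=\mathrm{Con}_2(B)$, $(f^* )^{-1}(\{\nabla_A\})=\{\nabla_B\}$ and $\mathrm{Max}(A)\subseteq \mathrm{Spec}(A)$, then $f$ is admissible and Max-admissible. (3) If $\mathcal{C}$ is congruence-modular, $\mathrm{Spec}(B)=\mathrm{Con}_2(B)$, $(f^* )^{-1}(\{\nabla_A\})=\{\nabla_B\}$ and $\nabla_A$ is finitely generated, then $f$ is admissible and Max-admissible. (4) If $\mathcal{C}$ is semi-degenerate and $\mathrm{Max}(B)=\mathrm{Con}_2(B)$, then $f$ is Max-admissible. (5) If $\mathcal{C}$ is semi-degenerate and congruence-modular and $\mathrm{Spec}(B)=\mathrm{Max}(B)=\mathrm{Con}_2(B)$, then $f$ is admissible and Max-admissible.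
   Context: All algebras are non-empty. $\mathrm{Con}(M)$ is the lattice of congruences of $M$ ordered by inclusion, with greatest element $\nabla_M=M^2$. $\mathrm{Con}_2(M)=\{\theta\in \mathrm{Con}(M) : |M/\theta|=2\}$; $\mathrm{Max}(M)$ is the set of maximal elements of $\mathrm{Con}(M)\setminus\{\nabla_M\}$. A congruence is finitely generated if it is the least congruence containing some finite set of pairs. The map $f^*:\mathrm{Con}(B)\to \mathrm{Con}(A)$ is given by $f^*(\psi)=\{(a,b)\in A^2 : (f(a),f(b))\in\psi\}$. The condition $(f^* )^{-1}(\{\nabla_A\})=\{\nabla_B\}$ says that, for $\psi\in \mathrm{Con}(B)$, $f^*(\psi)=\nabla_A$ iff $\psi=\nabla_B$. An equational class (variety) is congruence-modular if $\mathrm{Con}(M)$ is modular for each member $M$, and semi-degenerate if no algebra in it with at least two elements has a one-element subalgebra. In a congruence-modular equational class, $[\alpha,\beta]_M$ denotes the (Freese–McKenzie) commutator of $\alpha,\beta\in \mathrm{Con}(M)$: the least $\delta\in \mathrm{Con}(M)$ such that for all $m,n$, every $(m+n)$-ary term $t$, all $(a_i,b_i)\in\alpha$ ($1\le i\le m$) and all $(c_j,d_j)\in\beta$ ($1\le j\le n$), $(t(\bar a,\bar c),t(\bar a,\bar d))\in\delta$ implies $(t(\bar b,\bar c),t(\bar b,\bar d))\in\delta$. A congruence $\phi\neq\nabla_M$ is prime if, for all $\alpha,\beta\in \mathrm{Con}(M)$, $[\alpha,\beta]_M\subseteq\phi$ implies $\alpha\subseteq\phi$ or $\beta\subseteq\phi$;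 $\mathrm{Spec}(M)$ is the set of prime congruences of $M$. The morphism $f$ is Max-admissible if $f^*(\psi)\in \mathrm{Max}(A)$ for all $\psi\in \mathrm{Max}(B)$; if $\mathcal{C}$ is congruence-modular, $f$ is admissible if $f^*(\psi)\in \mathrm{Spec}(A)$ for all $\psi\in \mathrm{Spec}(B)$. *)

(* Defs.v *)
From mathcomp Require Import all_boot all_classical.

Set Implicit Arguments.
Unset Strict Implicit.
Unset Printing Implicit Defensive.

Local Open Scope classical_set_scope.

(** * Algebras of a finitary signature, terms, equational classes *)

Record signature := Signature { symbol : Type; arity : symbol -> nat }.

Record algebra (S : signature) := Algebra {
  carrier :> Type;
  interp : forall o : symbol S, ('I_(arity o) -> carrier) -> carrier;
  nonempty : inhabited carrier }.

Inductive term (S : signature) (V : Type) :=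
| Var of V
| App (o : symbol S) of ('I_(arity o) -> term S V).

Fixpoint eval (S : signature) (V : Type) (M : algebra S) (v : V -> M)
    (t : term S V) : M :=
  match t with
  | Var x => v x
  | App o ts => interp (fun i => eval v (ts i))
  end.

Definition equation (S : signature) := (term S nat * term S nat)%type.

Definition satisfies (S : signature) (M : algebra S) (e : equation S) :=
  forall v : nat -> M, eval v e.1 = eval v e.2.

(* Classes of algebras are bare predicates: [set (algebra S)] would force the
   universe of carriers strictly below that of the argument of [set], so that
   no algebra could be carried by a type of subsets, e.g. a quotient. *)
Definition equational_class (S : signature) (C : algebra S -> Prop) :=
  exists E : equation S -> Prop,
    forall M, C M <-> (forall e, E e -> satisfies M e).

Definition morphism (S : signature) (A B : algebra S) (f : A -> B) :=
  forall (o : symbol S) (a : 'I_(arity o) -> A),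
    f (interp a) = interp (fun i => f (a i)).

Definition subalgebra (S : signature) (M : algebra S) (X : set M) :=
  X !=set0 /\
  forall (o : symbol S) (a : 'I_(arity o) -> M),
    (forall i, X (a i)) -> X (interp a).

Definition semi_degenerate (S : signature) (C : algebra S -> Prop) :=
  forall M, C M -> (exists x y : M, x <> y) ->
    ~ exists a : M, subalgebra [set a].

(** * Congruences *)

Definition Con (S : signature) (M : algebra S) : set (set (M * M)) :=
  [set theta |
    [/\ forall x, theta (x, x),
        forall x y, theta (x, y) -> theta (y, x),
        forall x y z, theta (x, y) -> theta (y, z) -> theta (x, z)
      & forall (o : symbol S) (a b : 'I_(arity o) -> M),
          (forall i, theta (a i, b i)) -> theta (interp a, interp b)]].
Arguments Con {S} M.

Definition nabla (S : signature) (M : algebra S) : set (M * M) := setT.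
Arguments nabla {S} M.

Definition Cg (S : signature) (M : algebra S) (X : set (M * M)) :
  set (M * M) := smallest (Con M) X.

Definition finitely_generated (S : signature) (M : algebra S)
    (theta : set (M * M)) :=
  exists2 X : set (M * M), finite_set X & theta = Cg X.

Definition quotient_set (S : signature) (M : algebra S)
    (theta : set (M * M)) : set (set M) :=
  range (fun x : M => [set y | theta (x, y)]).

Definition Con2 (S : signature) (M : algebra S) : set (set (M * M)) :=
  [set theta | Con M theta /\ (quotient_set theta #= `I_2)%card].
Arguments Con2 {S} M.

Definition Max (S : signature) (M : algebra S) : set (set (M * M)) :=
  [set theta |
    [/\ Con M theta, theta <> nabla M
      & forall phi, Con M phi -> phi <> nabla M ->
          theta `<=` phi -> phi = theta]].
Arguments Max {S} M.

(* The meet and join in Con(M) are [`&`] and the congruence generated by the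
   union. *)
Definition modular_Con (S : signature) (M : algebra S) :=
  forall alpha beta gamma, Con M alpha -> Con M beta -> Con M gamma ->
    alpha `<=` gamma ->
    Cg (alpha `|` beta) `&` gamma = Cg (alpha `|` (beta `&` gamma)).

Definition congruence_modular (S : signature) (C : algebra S -> Prop) :=
  forall M, C M -> modular_Con M.

(** * Commutator and prime congruences *)

Definition concat (T : Type) (m n : nat) (a : 'I_m -> T) (c : 'I_n -> T)
    (i : 'I_(m + n)) : T :=
  match fintype.split i with inl j => a j | inr k => c k end.

Definition term_condition (S : signature) (M : algebra S)
    (alpha beta delta : set (M * M)) :=
  forall (m n : nat) (t : term S 'I_(m + n))
      (a b : 'I_m -> M) (c d : 'I_n -> M),
    (forall i, alpha (a i, b i)) -> (forall j, beta (c j, d j)) ->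
    delta (eval (concat a c) t, eval (concat a d) t) ->
    delta (eval (concat b c) t, eval (concat b d) t).

(* The congruences satisfying the term condition for fixed alpha and beta are
   closed under intersection, so this is the least of them. *)
Definition commutator (S : signature) (M : algebra S)
    (alpha beta : set (M * M)) : set (M * M) :=
  \bigcap_(delta in [set delta | Con M delta /\
                                 term_condition alpha beta delta]) delta.

Definition Spec (S : signature) (M : algebra S) : set (set (M * M)) :=
  [set phi |
    [/\ Con M phi, phi <> nabla M
      & forall alpha beta, Con M alpha -> Con M beta ->
          commutator alpha beta `<=` phi ->
          alpha `<=` phi \/ beta `<=` phi]].
Arguments Spec {S} M.

(** * Inverse images of congruences and admissible morphisms *)

Definition inverse_image (S : signature) (A B : algebra S) (f : A -> B)
    (psi : set (B * B)) : set (A * A) :=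
  [set p | psi (f p.1, f p.2)].

(* (f^* )^-1({nabla_A}) = {nabla_B}, where f^* has domain Con(B). *)
Definition reflects_nabla (S : signature) (A B : algebra S) (f : A -> B) :=
  Con B `&` inverse_image f @^-1` [set nabla A] = [set nabla B].

Definition Max_admissible (S : signature) (A B : algebra S) (f : A -> B) :=
  forall psi, Max B psi -> Max A (inverse_image f psi).

Definition admissible (S : signature) (A B : algebra S) (f : A -> B) :=
  forall psi, Spec B psi -> Spec A (inverse_image f psi).

(* Main.v *)
(* If psi has two classes and phi, its inverse image, is not nabla, then A/phi
   embeds in B/psi, so phi has two classes and is maximal; in a semi-degenerate
   class phi = nabla would make the image of A a one-element subalgebra of B/psi.
   When psi is also prime, A/phi = B/psi is not abelian.  In a modular class
   [alpha, beta] <= phi with alpha, beta not below phi gives the term condition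
   for (alpha, beta, phi), hence, phi having two classes, for
   (nabla, nabla, phi): A/phi would be abelian, so phi is prime.

   In (3) a maximal psi need not have two classes.  If it is not prime, B/psi is
   simple and abelian, and congruences extend from subalgebras of abelian
   algebras, so the image of A in B/psi is simple.

   The commutator theory used rests on Gumm's shifting lemma, applied to
   subalgebras of products of two algebras; no Day or Gumm terms are needed. *)

Require Import Defs.
From mathcomp Require Import all_boot all_classical.
From Stdlib Require Import Relation_Operators.

Set Implicit Arguments.
Unset Strict Implicit.
Unset Printing Implicit Defensive.

Local Open Scope classical_set_scope.

(** * Congruences, generated congruences and the shifting property *)

Section Congruences.
Variables (S : signature) (M : algebra S).
Implicit Types theta phi : set (M * M).

Lemma Con_nabla : Con M (nabla M).
Proof. by split. Qed.

Lemma Con_setI theta phi : Con M theta -> Con M phi -> Con M (theta `&` phi).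
Proof.
move=> [r1 s1 t1 c1] [r2 s2 t2 c2]; split.
- by [].
- by move=> x y [/s1 ? /s2 ?].
- by move=> x y z [/t1 h1 /t2 h2] [/h1 ? /h2 ?].
- by move=> o a b h; split; [apply: c1 => i|apply: c2 => i]; case: (h i).
Qed.

Lemma Con_bigcap (P : set (set (M * M))) :
  P `<=` Con M -> Con M (\bigcap_(theta in P) theta).
Proof.
move=> PC; split.
- by move=> x theta /PC[].
- by move=> x y h theta Pt; have [_ + _ _] := PC _ Pt; apply; apply: h.
- move=> x y z hxy hyz theta Pt; have [_ _ + _] := PC _ Pt.
  by apply; [apply: hxy|apply: hyz].
- move=> o a b h theta Pt; have [_ _ _] := PC _ Pt.
  by apply => i; apply: h.
Qed.

Lemma Con_Cg (X : set (M * M)) : Con M (Cg X).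
Proof. by apply: Con_bigcap => theta []. Qed.

Lemma eval_Con theta (V : Type) (v w : V -> M) (t : term S V) :
  Con M theta -> (forall x, theta (v x, w x)) ->
  theta (eval v t, eval w t).
Proof. by move=> [_ _ _ c] h; elim: t => [x|o ts IH] /=; [apply: h|apply: c]. Qed.

Definition shifting_property := forall alpha beta gamma x y z u,
  Con M alpha -> Con M beta -> Con M gamma -> alpha `&` beta `<=` gamma ->
  alpha (x, y) -> alpha (z, u) -> beta (x, z) -> beta (y, u) ->
  gamma (x, z) -> gamma (y, u).

(* Gumm's shifting lemma. *)
Lemma shifting : modular_Con M -> shifting_property.
Proof.
move=> mod al be ga x y z u Cal Cbe Cga sub axy azu bxz byu gxz.
have Cbg := Con_setI Cbe Cga.
(* By the modular law, the join of [al] with the meet of [be] and [ga], once met with [be], stays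
   inside [ga]. The pair (y, u) lies in it through the path y, x, z, u. *)
have := mod _ _ _ Cbg Cal Cbe (@subIsetl _ _ _).
move=> /seteqP[/(_ (y, u)) + _] => h.
have : (Cg (be `&` ga `|` al) `&` be) (y, u).
  split=> //; have [_ s t _] := Con_Cg (be `&` ga `|` al).
  have gen := @sub_gen_smallest _ (Con M) (be `&` ga `|` al).
  apply: (t _ x); first by apply: s; apply: gen; right.
  by apply: (t _ z); [apply: gen; left|apply: gen; right].
by move=> /h; apply; split=> // p [[]//|?]; apply: sub.
Qed.

(** The arguments are exchanged one at a time, the first [n] of them after [n] steps; beyond the
    arity a step changes nothing. *)
Lemma coordinatewise_compatible (rho : M -> M -> Prop) :
  (forall x, rho x x) -> (forall x y z, rho x y -> rho y z -> rho x z) ->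
  (forall (o : symbol S) (e : 'I_(arity o) -> M) i x y, rho x y ->
    rho (interp (fun k => if k == i then x else e k))
        (interp (fun k => if k == i then y else e k))) ->
  forall (o : symbol S) (a b : 'I_(arity o) -> M),
    (forall i, rho (a i) (b i)) -> rho (interp a) (interp b).
Proof.
move=> rfl trn one o a b ab.
suff step n : rho (interp a) (interp (fun k => if (k < n)%N then b k else a k)).
  have := step (arity o); congr rho; congr interp.
  by apply: funext => k; rewrite ltn_ord.
elim: n => [|n IH]; first exact: rfl.
apply: trn IH _; have [ln|ln] := ltnP n (arity o); last first.
  have := rfl (interp (fun k => if (k < n)%N then b k else a k)).
  congr rho; congr interp; apply: funext => k.
  by rewrite (leq_trans (ltn_ord k) ln) (leq_trans (ltn_ord k) (leqW ln)).
pose i := Ordinal ln.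
have := one o (fun k => if (k < n)%N then b k else a k) i _ _ (ab i).
congr rho; congr interp; apply: funext => k.
- by case: eqP => // ->; rewrite ltnn.
- case: (eqVneq k i) => [->|ki]; first by rewrite ltnSn.
  rewrite [in RHS]ltnS [in RHS]leq_eqVlt.
  by rewrite (_ : (k == n :> nat) = false) //; apply: negbTE ki.
Qed.

(** A chain of [rho]-steps in one argument of an operation becomes a chain of [rho]-steps between
    its values, so compatibility need only be tested on single steps in single coordinates. *)
Lemma Con_clos (rho : M -> M -> Prop) :
  (forall x y, rho x y -> rho y x) ->
  (forall (o : symbol S) (e : 'I_(arity o) -> M) i x y, rho x y ->
    rho (interp (fun k => if k == i then x else e k))
        (interp (fun k => if k == i then y else e k))) ->
  Con M [set p | clos_refl_trans M rho p.1 p.2].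
Proof.
move=> sym one; split=> /=.
- by move=> x; apply: rt_refl.
- move=> x y; elim => [p q /sym ?|p|p q r _ h1 _ h2].
  + exact: rt_step.
  + exact: rt_refl.
  + exact: rt_trans h2 h1.
- by move=> x y z; apply: rt_trans.
- apply: coordinatewise_compatible.
  + by move=> x; apply: rt_refl.
  + by move=> x y z; apply: rt_trans.
  + move=> o e i x y; elim => [p q pq|p|p q r _ h1 _ h2].
    * by apply: rt_step; apply: one.
    * exact: rt_refl.
    * exact: rt_trans h1 h2.
Qed.

End Congruences.

(** * Terms and congruences along a morphism *)

Section Pullback.
Variables (S : signature) (A B : algebra S) (f : A -> B).
Hypothesis hf : morphism f.

Lemma eval_morphism (V : Type) (v : V -> A) (t : term S V) :
  f (eval v t) = eval (f \o v) t.
Proof.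
elim: t => //= o ts IH; rewrite hf; congr interp.
by apply: funext => i; apply: IH.
Qed.

Lemma Con_inverse_image psi : Con B psi -> Con A (inverse_image f psi).
Proof.
move=> [r s t c]; split; rewrite /inverse_image /=.
- by move=> x; apply: r.
- by move=> x y; apply: s.
- by move=> x y z; apply: t.
- by move=> o a b h; rewrite !hf; apply: c.
Qed.

End Pullback.

(** * Subalgebras of a product of two algebras *)

Section Subproduct.
Variables (S : signature) (A B : algebra S) (R : set (A * B)).
Hypothesis R0 : R !=set0.
Hypothesis Rop : forall (o : symbol S) (a : 'I_(arity o) -> A * B),
  (forall i, R (a i)) ->
  R (interp (fun i => (a i).1), interp (fun i => (a i).2)).

(** Kept transparent, so that the projections commute with the operations by computation. *)
Definition subproduct : algebra S.
Proof.
refine (@Algebra S {p | R p} (fun o a =>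
  exist _ (interp (fun i => (sval (a i)).1), interp (fun i => (sval (a i)).2))
    (Rop (fun i => svalP (a i)))) _).
by case: R0 => p Rp; apply: inhabits; exists p.
Defined.

Definition proj1 (r : subproduct) : A := (sval r).1.
Definition proj2 (r : subproduct) : B := (sval r).2.

Lemma subproduct_inj (r s : subproduct) :
  proj1 r = proj1 s -> proj2 r = proj2 s -> r = s.
Proof.
case: r s => [[p q] h] [[p' q'] h']; rewrite /proj1 /proj2 /= => e1 e2.
by move: h h'; rewrite e1 e2 => h h'; congr exist; apply: Prop_irrelevance.
Qed.

Lemma morphism_proj1 : morphism proj1. Proof. by []. Qed.
Lemma morphism_proj2 : morphism proj2. Proof. by []. Qed.

Lemma equational_subproduct (C : algebra S -> Prop) :
  equational_class C -> C A -> C B -> C subproduct.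
Proof.
move=> [E hE] /hE hA /hE hB; apply/hE => e Ee v; apply: subproduct_inj.
- by rewrite !(eval_morphism morphism_proj1); apply: hA.
- by rewrite !(eval_morphism morphism_proj2); apply: hB.
Qed.

Definition ker1 : set (subproduct * subproduct) := [set p | proj1 p.1 = proj1 p.2].
Definition ker2 : set (subproduct * subproduct) := [set p | proj2 p.1 = proj2 p.2].

Lemma Con_ker1 : Con subproduct ker1.
Proof.
split; rewrite /ker1 //=; first by move=> x y z ->.
by move=> o a b h; rewrite !morphism_proj1; congr interp; apply: funext.
Qed.

Lemma Con_ker2 : Con subproduct ker2.
Proof.
split; rewrite /ker2 //=; first by move=> x y z ->.
by move=> o a b h; rewrite !morphism_proj2; congr interp; apply: funext.
Qed.

(** The two kernels meet in equality. Hence the side condition of the shifting lemma holds for them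
    together with any third congruence. *)
Lemma ker12 theta : Con subproduct theta -> ker1 `&` ker2 `<=` theta.
Proof. by move=> [r _ _ _] [p q] [h1 h2]; have /= -> := subproduct_inj h1 h2. Qed.

End Subproduct.

Arguments proj1 {S A B R R0 Rop} r.
Arguments proj2 {S A B R R0 Rop} r.

(** * Terms in two blocks of variables *)

Section ConcatLemmas.
Variables (T : Type) (m n : nat) (a : 'I_m -> T) (c : 'I_n -> T).

Lemma concat_lshift i : concat a c (lshift n i) = a i.
Proof. by rewrite /concat (unsplitK (inl i)). Qed.

Lemma concat_rshift j : concat a c (rshift m j) = c j.
Proof. by rewrite /concat (unsplitK (inr j)). Qed.

End ConcatLemmas.

Lemma comp_concat (T U : Type) (g : T -> U) m n (a : 'I_m -> T) (c : 'I_n -> T) :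
  g \o concat a c = concat (g \o a) (g \o c).
Proof. by apply: funext => i; rewrite /concat /=; case: fintype.split. Qed.

Fixpoint rename (S : signature) (V W : Type) (g : V -> W) (t : term S V) :
    term S W :=
  match t with
  | Var x => Var S (g x)
  | App o ts => App (fun i => rename g (ts i))
  end.

Lemma eval_rename (S : signature) (M : algebra S) (V W : Type) (g : V -> W)
  (v : W -> M) (t : term S V) : eval v (rename g t) = eval (v \o g) t.
Proof. by elim: t => //= o ts IH; congr interp; apply: funext. Qed.

(** * The term condition as a congruence on the algebra of a congruence *)

Section CongruenceAlgebra.
Variables (S : signature) (M : algebra S) (beta : set (M * M)).
Hypothesis Cbeta : Con M beta.

Lemma Con_nonempty : beta !=set0.
Proof. by have [x] := Defs.nonempty M; exists (x, x); case: Cbeta => r _ _ _; apply: r. Qed.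

Lemma Con_op (o : symbol S) (a : 'I_(arity o) -> M * M) :
  (forall i, beta (a i)) ->
  beta (interp (fun i => (a i).1), interp (fun i => (a i).2)).
Proof. by case: Cbeta => _ _ _ c h; apply: c => i; rewrite -surjective_pairing. Qed.

(** The elements are the possible rows of the matrices in the term condition. *)
Definition Con_algebra := subproduct Con_nonempty Con_op.

Definition mkpair x y (h : beta (x, y)) : Con_algebra := exist _ (x, y) h.

(* [D] contains the congruence usually denoted Delta_(alpha,beta); the last
   clause restates the term condition. *)
Definition central_witness (alpha delta : set (M * M))
    (D : set (Con_algebra * Con_algebra)) :=
  [/\ Con Con_algebra D,
      forall r s : Con_algebra, proj1 r = proj2 r -> proj1 s = proj2 s ->
        alpha (proj1 r, proj1 s) -> D (r, s),
      forall r s : Con_algebra, delta (proj1 r, proj1 s) ->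
        delta (proj2 r, proj2 s) -> D (r, s)
    & forall r s : Con_algebra, D (r, s) -> delta (proj1 r, proj2 r) ->
        delta (proj1 s, proj2 s)].

(* [D] is the transitive closure of [delta] on each coordinate together with the
   matrices of terms in which a single [alpha]-argument moves. *)
Lemma term_condition_witness alpha delta : Con M alpha -> Con M delta ->
  term_condition alpha beta delta -> exists D, central_witness alpha delta D.
Proof.
move=> [_ asym _ _] Cdel tc; have [dr ds dt dc] := Cdel.
pose poly (r s : Con_algebra) :=
  exists n (t : term S 'I_(1 + n)) (a b : 'I_1 -> M) (c d : 'I_n -> M),
    [/\ forall i, alpha (a i, b i), forall j, beta (c j, d j),
        sval r = (eval (concat a c) t, eval (concat a d) t)
      & sval s = (eval (concat b c) t, eval (concat b d) t)].
pose rho r s := poly r s \/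
  (delta (proj1 r, proj1 s) /\ delta (proj2 r, proj2 s)).
exists [set p | clos_refl_trans _ rho p.1 p.2]; split.
- apply: Con_clos.
  + move=> r s [[n [t [a [b [c [d [ab cd hr hs]]]]]]]|[h1 h2]].
      left; exists n, t, b, a, c, d; split=> // i; exact: asym.
    by right; split; apply: ds.
  + move=> o e i r s [[n [t [a [b [c [d [ab cd hr hs]]]]]]]|[h1 h2]]; last first.
      by right; split; apply: dc => k; case: (k == i) => //=; apply: dr.
    left.
    pose g (x : 'I_(1 + n)) : 'I_(1 + (n + arity o)) :=
      match fintype.split x with
      | inl j => lshift _ j
      | inr j => rshift 1 (lshift (arity o) j)
      end.
    pose c' := concat c (fun k => (sval (e k)).1).
    pose d' := concat d (fun k => (sval (e k)).2).
    have cg u : concat u c' \o g = concat u c.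
      apply: funext => x; rewrite /g /= [RHS]/concat.
      by case: fintype.split => j; rewrite ?concat_lshift // concat_rshift /c' concat_lshift.
    have dg u : concat u d' \o g = concat u d.
      apply: funext => x; rewrite /g /= [RHS]/concat.
      by case: fintype.split => j; rewrite ?concat_lshift // concat_rshift /d' concat_lshift.
    exists (n + arity o), (App (fun k => if k == i then rename g t
      else Var S (rshift 1 (rshift n k)))), a, b, c', d'; split=> //.
    * move=> j; rewrite /c' /d' /concat; case: fintype.split => k //.
      by rewrite -surjective_pairing; apply: svalP.
    * rewrite /=; congr pair; congr interp; apply: funext => k; case: (k == i);
        by rewrite ?eval_rename ?cg ?dg ?hr //= /c' /d' !concat_rshift.
    * rewrite /=; congr pair; congr interp; apply: funext => k; case: (k == i);
        by rewrite ?eval_rename ?cg ?dg ?hs //= /c' /d' !concat_rshift.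
- move=> r s er es ars; apply: rt_step; left.
  (* The term is the single [alpha]-variable and the block of [beta]-parameters is empty. *)
  exists 0, (Var S (lshift 0 ord0)), (fun=> proj1 r), (fun=> proj1 s).
  exists (fun=> proj1 r), (fun=> proj1 r); split=> //=; first by case.
  + by rewrite !concat_lshift {2}er -surjective_pairing.
  + by rewrite !concat_lshift {2}es -surjective_pairing.
- by move=> r s h1 h2; apply: rt_step; right.
- move=> r s /=; elim => [p q pq|//|p q w _ h1 _ h2 h]; last by apply: h2; apply: h1.
  case: pq => [[n [t [a [b [c [d [ab cd hr hs]]]]]]]|[h1 h2] h].
    by rewrite /proj1 /proj2 hr hs /=; apply: tc.
  exact: (dt _ _ _ (dt _ _ _ (ds _ _ h1) h) h2).
Qed.

End CongruenceAlgebra.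

(** * Monotonicity and symmetry of the term condition under modularity *)

Section Commutator.
Variables (S : signature) (C : algebra S -> Prop).
Hypotheses (hC : equational_class C) (mod : congruence_modular C).
Variable M : algebra S.
Hypothesis hM : C M.
Implicit Types alpha beta delta phi : set (M * M).

Section Witness.
Variables (alpha beta delta : set (M * M)).
Hypotheses (Calpha : Con M alpha) (Cbeta : Con M beta) (Cdelta : Con M delta).
Variable D : set (Con_algebra Cbeta * Con_algebra Cbeta).
Hypothesis DP : central_witness alpha delta D.

Let shift := shifting (mod (equational_subproduct (Con_nonempty Cbeta)
  (Con_op Cbeta) hC hM hM)).

(** Shifting along [ker2] replaces the common first coordinate [p] by [q], so that one of the two
    elements becomes diagonal; the last clause of [central_witness] then applies. *)
Lemma witness_ker1 r s :
  D (r, s) -> proj1 r = proj1 s -> delta (proj2 r, proj2 s).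
Proof.
have [CD _ _ Dsat] := DP; have [Dr _ _ _] := CD.
have [br bs bt _] := Cbeta; have [dr _ _ _] := Cdelta.
case: r s => [[p q] hpq] [[p' t] hpt] h e; rewrite /proj1 /= in e; subst p'.
have hqt : beta (q, t) := bt _ _ _ (bs _ _ hpq) hpt.
have := @shift _ _ _ (mkpair Cbeta hpq) (mkpair Cbeta (br q))
   (mkpair Cbeta hpt) (mkpair Cbeta hqt) (Con_ker2 _ _) (Con_ker1 _ _) CD.
rewrite setIC => /(_ (ker12 CD) erefl erefl erefl erefl h) /Dsat; apply.
exact: dr.
Qed.

(** Mirror image of [witness_ker1]: shifting along [ker1] replaces the common second coordinate by
    [p]. *)
Lemma witness_ker2 r s :
  D (r, s) -> proj2 r = proj2 s -> delta (proj1 r, proj1 s).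
Proof.
have [CD _ _ Dsat] := DP; have [_ Ds _ _] := CD.
have [br bs bt _] := Cbeta; have [dr ds _ _] := Cdelta.
case: r s => [[p q] hpq] [[t q'] htq] h e; rewrite /proj2 /= in e; subst q'.
have htp : beta (t, p) := bt _ _ _ htq (bs _ _ hpq).
have := @shift _ _ _ (mkpair Cbeta hpq) (mkpair Cbeta (br p))
   (mkpair Cbeta htq) (mkpair Cbeta htp) (Con_ker1 _ _) (Con_ker2 _ _) CD.
move=> /(_ (ker12 CD) erefl erefl erefl erefl h) /Dsat hs.
by apply: ds; apply: hs; apply: dr.
Qed.

(* Shift along [ker1] from the diagonal. *)
Lemma witness_saturates_above phi : Con M phi -> delta `<=` phi ->
  forall r s, D (r, s) -> alpha (proj1 r, proj1 s) ->
  phi (proj1 r, proj2 r) -> phi (proj1 s, proj2 s).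
Proof.
move=> Cphi sub r s h ars hr; have [CD Dd _ _] := DP.
have [br _ _ _] := Cbeta.
pose dg x := mkpair Cbeta (br x).
(* The third congruence is the pullback of [phi] along [proj2]; it contains the meet of [D] and
   [ker1] by [witness_ker1]. *)
have := @shift _ _ _ (dg (proj1 r)) (dg (proj1 s)) r s CD (Con_ker1 _ _)
  (Con_inverse_image (@morphism_proj2 _ _ _ _ _ _) Cphi).
apply=> //; last exact: Dd.
by move=> [u v] [d e]; apply: sub; apply: witness_ker1 d e.
Qed.

(* Shift along [ker2] to the diagonal. *)
Lemma witness_transpose r s : D (r, s) -> alpha (proj2 r, proj2 s) ->
  delta (proj1 r, proj1 s) -> delta (proj2 r, proj2 s).
Proof.
move=> h ars hr; have [CD Dd _ _] := DP.
have [br _ _ _] := Cbeta.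
pose dg x := mkpair Cbeta (br x).
have := @shift _ _ _ r (dg (proj2 r)) s (dg (proj2 s)) (Con_ker2 _ _) CD
  (Con_inverse_image (@morphism_proj1 _ _ _ _ _ _) Cdelta).
apply=> //; last exact: Dd.
by move=> [u v] [e d]; apply: witness_ker2 d e.
Qed.

End Witness.

Section Terms.
Variables (alpha beta delta : set (M * M)).
Hypotheses (Calpha : Con M alpha) (Cbeta : Con M beta) (Cdelta : Con M delta).

Lemma eval_Con_algebra (V : Type) (v : V -> Con_algebra Cbeta) (t : term S V) :
  proj1 (eval v t) = eval (proj1 \o v) t /\
  proj2 (eval v t) = eval (proj2 \o v) t.
Proof.
by rewrite (eval_morphism (@morphism_proj1 _ _ _ _ _ _)) (eval_morphism (@morphism_proj2 _ _ _ _ _ _)).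
Qed.

(** The two rows of a matrix are values of [t] in the algebra [beta], hence [D]-related, and
    [witness_saturates_above] lets [D] transport [phi] from one row to the other. *)
Lemma term_condition_mono phi : Con M phi -> delta `<=` phi ->
  term_condition alpha beta delta -> term_condition alpha beta phi.
Proof.
move=> Cphi sub /(term_condition_witness Cbeta Calpha Cdelta)[D DP].
move=> m n t a b c d ab cd h.
have [CD Dd _ _] := DP; have [br _ _ _] := Cbeta; have [Dr _ _ _] := CD.
have [ar _ _ _] := Calpha.
pose dg x := mkpair Cbeta (br x).
pose e j := mkpair Cbeta (cd j).
have h1 (x : 'I_m -> M) : proj1 \o concat (dg \o x) e = concat x c.
  by rewrite comp_concat.
have h2 (x : 'I_m -> M) : proj2 \o concat (dg \o x) e = concat x d.
  by rewrite comp_concat.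
have [r1 r2] := eval_Con_algebra (concat (dg \o a) e) t.
have [s1 s2] := eval_Con_algebra (concat (dg \o b) e) t.
rewrite -(h1 b) -(h2 b) -s1 -s2.
apply: (witness_saturates_above Cdelta DP Cphi sub (r := eval (concat (dg \o a) e) t)).
- apply: eval_Con => // i; rewrite /concat; case: fintype.split => j.
    by apply: Dd => //; apply: ab.
  exact: Dr.
- rewrite r1 s1; apply: eval_Con => // i.
  rewrite !h1 /concat; case: fintype.split => j; [exact: ab|exact: ar].
- by rewrite r1 r2 h1 h2.
Qed.

(** Here [a] and [b] pair up to elements of the algebra [beta], so the columns of the matrix are its
    elements and are [D]-related. By [witness_transpose], [delta] passes from the first coordinates
    to the second. *)
Lemma term_condition_sym :
  term_condition alpha beta delta -> term_condition beta alpha delta.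
Proof.
move=> /(term_condition_witness Cbeta Calpha Cdelta)[D DP].
move=> m n t a b c d ab cd h.
have [CD Dd _ _] := DP; have [br _ _ _] := Cbeta; have [Dr _ _ _] := CD.
have [ar _ _ _] := Calpha.
pose dg x := mkpair Cbeta (br x).
pose e j := mkpair Cbeta (ab j).
have h1 (x : 'I_n -> M) : proj1 \o concat e (dg \o x) = concat a x.
  by rewrite comp_concat.
have h2 (x : 'I_n -> M) : proj2 \o concat e (dg \o x) = concat b x.
  by rewrite comp_concat.
have [r1 r2] := eval_Con_algebra (concat e (dg \o c)) t.
have [s1 s2] := eval_Con_algebra (concat e (dg \o d)) t.
rewrite -(h2 c) -(h2 d) -r2 -s2.
apply: (witness_transpose Cdelta DP).
- apply: eval_Con => // i; rewrite /concat; case: fintype.split => j.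
    exact: Dr.
  by apply: Dd => //; apply: cd.
- rewrite r2 s2; apply: eval_Con => // i.
  rewrite !h2 /concat; case: fintype.split => j; [exact: ar|exact: cd].
- by rewrite r1 s1 !h1.
Qed.

End Terms.

Lemma Con_commutator alpha beta : Con M (commutator alpha beta).
Proof. by apply: Con_bigcap => delta []. Qed.

Lemma term_condition_commutator alpha beta :
  term_condition alpha beta (commutator alpha beta).
Proof.
move=> m n t a b c d ab cd h delta [Cd tc].
exact: (tc _ _ _ _ _ _ _ ab cd (h _ (conj Cd tc))).
Qed.

Lemma term_condition_above_commutator alpha beta phi :
  Con M alpha -> Con M beta -> Con M phi -> commutator alpha beta `<=` phi ->
  term_condition alpha beta phi.
Proof.
move=> Ca Cb Cp sub.
apply: (term_condition_mono Ca Cb (Con_commutator _ _) Cp sub).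
exact: term_condition_commutator.
Qed.

(** At most two classes, as a pigeonhole on three elements: this form passes to inverse images
    without any counting. *)
Definition two_classes (phi : set (M * M)) :=
  forall x y z, [\/ phi (x, y), phi (x, z) | phi (y, z)].

(** A pair of [alpha] outside [phi] represents both classes of [phi], and likewise for [beta].
    Replacing every argument by its representative changes values only within [phi] and makes
    arbitrary arguments [alpha]- or [beta]-related. *)
Lemma term_condition_two_classes alpha beta phi : Con M phi -> two_classes phi ->
  Con M alpha -> Con M beta ->
  ~ alpha `<=` phi -> ~ beta `<=` phi -> term_condition alpha beta phi ->
  term_condition (nabla M) (nabla M) phi.
Proof.
move=> Cphi two Ca Cb.
have pick theta : Con M theta -> ~ theta `<=` phi ->
    exists g : M -> M, forall x, phi (x, g x) /\ forall y, theta (g x, g y).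
  move=> [tr ts _ _] /existsNP[[p q]] /not_implyP[tpq npq].
  have [_ ps _ _] := Cphi.
  have ex x : exists z, phi (x, z) /\ (z = p \/ z = q).
    case: (two x p q) => h; [by exists p; tauto|by exists q; tauto|by []].
  have [g hg] := choice ex.
  exists g => x; split; first by case: (hg x).
  by move=> y; case: (hg x) => _ [] ->; case: (hg y) => _ [] ->; try exact: tr;
    try exact: tpq; apply: ts.
move=> /(pick _ Ca)[g hg] /(pick _ Cb)[k hk] tc m n t a b c d _ _ h.
have [_ ps pt _] := Cphi.
have move_eval u v : phi (eval (concat u v) t, eval (concat (g \o u) (k \o v)) t).
  apply: eval_Con => // i; rewrite /concat; case: fintype.split => j.
    by case: (hg (u j)).
  by case: (hk (v j)).
have hgk : phi (eval (concat (g \o a) (k \o c)) t, eval (concat (g \o a) (k \o d)) t).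
  exact: (pt _ _ _ (ps _ _ (move_eval a c)) (pt _ _ _ h (move_eval a d))).
have ab' i : alpha ((g \o a) i, (g \o b) i) by case: (hg (a i)) => _; apply.
have cd' j : beta ((k \o c) j, (k \o d) j) by case: (hk (c j)) => _; apply.
have h2 := tc _ _ _ _ _ _ _ ab' cd' hgk.
exact: (pt _ _ _ (pt _ _ _ (move_eval b c) h2) (ps _ _ (move_eval b d))).
Qed.

End Commutator.

(** * Congruences with two classes *)

Section TwoClasses.
Variables (S : signature) (M : algebra S).
Implicit Types phi theta : set (M * M).

Lemma Con2_two_classes phi : Con2 M phi -> two_classes phi.
Proof.
move=> [[pr ps pt _]]; rewrite card_eq_le => /andP[/pcard_leP/injfunPex[g gI ginj] _].
pose cl x : set M := [set y | phi (x, y)].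
have q u : quotient_set phi (cl u) by exists u.
have rel u v : g (cl u) = g (cl v) -> phi (u, v).
  move=> /ginj; rewrite !inE => /(_ (q u) (q v)) e.
  by suff : cl u v by []; rewrite e //; apply: pr.
have g2 u : (g (cl u) < 2)%N by apply: gI.
move=> x y z; move: (g2 x) (g2 y) (g2 z) (@rel x y) (@rel x z) (@rel y z).
case: (g (cl x)) => [|[|//]]; case: (g (cl y)) => [|[|//]];
  case: (g (cl z)) => [|[|//]] _ _ _ h1 h2 h3;
  by [apply: Or31; apply: h1|apply: Or32; apply: h2|apply: Or33; apply: h3].
Qed.

(** A congruence strictly above [phi] contains a pair meeting both classes, so it relates
    everything. *)
Lemma Max_two_classes phi :
  Con M phi -> phi <> nabla M -> two_classes phi -> Max M phi.
Proof.
move=> Cphi nphi two; split=> // theta Cth nth sub; have [_ ts tt _] := Cth.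
apply/seteqP; split=> // -[x y] txy; apply: contrapT => nxy; apply: nth.
have all z : theta (x, z).
  case: (two x y z) => // h; first exact: sub.
  exact: (tt _ _ _ txy (sub _ h)).
by apply/seteqP; split=> // -[u v] _; apply: (tt _ _ _ (ts _ _ (all u)) (all v)).
Qed.

End TwoClasses.

(** * Quotient algebras on chosen representatives *)

Section Quotient.
Variables (S : signature) (M : algebra S) (psi : set (M * M)).
Hypothesis Cpsi : Con M psi.

Let class_nonempty x : exists y, psi (x, y).
Proof. by exists x; case: Cpsi. Qed.

Definition repr x : M := sval (cid (class_nonempty x)).

Lemma repr_rel x : psi (x, repr x).
Proof. exact: svalP (cid (class_nonempty x)). Qed.

(** Related elements have equal classes as predicates, so by proof irrelevance the choice made in
    [repr] is the same. *)
Lemma eq_repr x y : psi (x, y) -> repr x = repr y.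
Proof.
have [_ ps pt _] := Cpsi => xy; rewrite /repr.
have e : (fun z => psi (x, z)) = (fun z => psi (y, z)).
  apply: funext => z; apply: propext; split => h.
    exact: (pt _ _ _ (ps _ _ xy) h).
  exact: (pt _ _ _ xy h).
move: (class_nonempty x) (class_nonempty y); rewrite e => h1 h2.
by rewrite (Prop_irrelevance h1 h2).
Qed.

Lemma reprK x : repr (repr x) = repr x.
Proof. by apply/esym/eq_repr/repr_rel. Qed.

Definition quotient : algebra S.
Proof.
refine (@Algebra S {x | repr x = x}
  (fun o a => exist _ (repr (interp (fun i => sval (a i)))) (reprK _)) _).
by have [x] := Defs.nonempty M; apply: inhabits; exists (repr x); apply: reprK.
Defined.

Definition to_quotient x : quotient := exist _ (repr x) (reprK x).

Lemma quotient_inj (u v : quotient) : sval u = sval v -> u = v.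
Proof.
case: u v => [x h] [y h'] /= e; move: h h'; rewrite e => h h'.
by congr exist; apply: Prop_irrelevance.
Qed.

Lemma to_quotient_eq x y : to_quotient x = to_quotient y <-> psi (x, y).
Proof.
have [_ ps pt _] := Cpsi; split=> [/(congr1 sval) /= e|xy].
  by apply: (pt _ _ _ (repr_rel x)); rewrite e; apply/ps/repr_rel.
by apply: quotient_inj; apply: eq_repr.
Qed.

Lemma morphism_to_quotient : morphism to_quotient.
Proof.
move=> o a; apply: quotient_inj => /=; apply: eq_repr.
by have [_ _ _ c] := Cpsi; apply: c => i; apply: repr_rel.
Qed.

Lemma equational_quotient (C : algebra S -> Prop) :
  equational_class C -> C M -> C quotient.
Proof.
move=> [E hE] /hE hM; apply/hE => e Ee v.
(* Every valuation in the quotient lifts to [M] through the representatives. *)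
have -> : v = to_quotient \o (fun n => sval (v n)).
  by apply: funext => n; apply: quotient_inj; rewrite /= (svalP (v n)).
by rewrite -!(eval_morphism morphism_to_quotient) hM.
Qed.

End Quotient.

(** * Properness and primality of inverse images *)

Section InverseImage.
Variables (S : signature) (A B : algebra S) (f : A -> B).
Hypothesis hf : morphism f.

Lemma two_classes_inverse_image psi :
  two_classes psi -> two_classes (inverse_image f psi).
Proof. by move=> two x y z; apply: two. Qed.

Lemma reflects_nabla_neq psi : reflects_nabla f -> Con B psi ->
  psi <> nabla B -> inverse_image f psi <> nabla A.
Proof. by move=> /seteqP[h _] Cpsi npsi e; apply: npsi; apply: (h psi). Qed.

Lemma semi_degenerate_neq (C : algebra S -> Prop) psi : equational_class C ->
  C B -> semi_degenerate C -> Con B psi -> psi <> nabla B ->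
  inverse_image f psi <> nabla A.
Proof.
move=> hC hB sd Cpsi npsi e; have [a0] := Defs.nonempty A.
have all a a' : psi (f a, f a').
  have : inverse_image f psi (a, a') by rewrite e.
  by [].
apply: (sd (quotient Cpsi)); first exact: equational_quotient.
  apply: contrapT => h; apply: npsi; apply/seteqP; split=> // -[x y] _.
  apply/to_quotient_eq; apply: contrapT => xy; apply: h.
  by exists (to_quotient Cpsi x), (to_quotient Cpsi y).
exists (to_quotient Cpsi (f a0)); split; first by eexists.
move=> o a ha; have -> : a = to_quotient Cpsi \o (fun=> f a0).
  by apply: funext => i; rewrite ha.
rewrite -morphism_to_quotient; apply/to_quotient_eq.
by rewrite -(hf (fun=> a0)); apply: all.
Qed.

(** The image of [f] meets both classes of [psi], so every element of [B] is [psi]-related to some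
    [f a], and matrices in [B] lift to [A] modulo [psi]. *)
Lemma term_condition_nabla_inverse_image psi : Con B psi -> two_classes psi ->
  inverse_image f psi <> nabla A ->
  term_condition (nabla A) (nabla A) (inverse_image f psi) ->
  term_condition (nabla B) (nabla B) psi.
Proof.
move=> Cpsi two nabla_neq tc; have [_ ps pt _] := Cpsi.
have [a0 [a1 n01]] : exists a0 a1, ~ psi (f a0, f a1).
  apply: contrapT => h; apply: nabla_neq; apply/seteqP; split=> // -[x y] _.
  by apply: contrapT => xy; apply: h; exists x, y.
have lift y : exists a, psi (y, f a).
  by case: (two y (f a0) (f a1)) => // h; [exists a0|exists a1].
have [g hg] := choice lift.
have lift_eval m n (t : term S 'I_(m + n)) u v :
    psi (eval (concat u v) t, f (eval (concat (g \o u) (g \o v)) t)).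
  rewrite (eval_morphism hf) comp_concat; apply: eval_Con => // i.
  by rewrite /concat; case: fintype.split => j; apply: hg.
move=> m n t a b c d _ _ h.
have h1 : inverse_image f psi (eval (concat (g \o a) (g \o c)) t,
                               eval (concat (g \o a) (g \o d)) t).
  exact: (pt _ _ _ (ps _ _ (lift_eval _ _ t a c)) (pt _ _ _ h (lift_eval _ _ t a d))).
have h2 := tc _ _ _ _ (g \o b) _ _ (fun=> I) (fun=> I) h1.
exact: (pt _ _ _ (pt _ _ _ (lift_eval _ _ t b c) h2) (ps _ _ (lift_eval _ _ t b d))).
Qed.

(** Otherwise [psi] would contain the commutator of [nabla B] with itself, hence [nabla B] by
    primality. *)
Lemma Spec_not_abelian psi :
  Spec B psi -> ~ term_condition (nabla B) (nabla B) psi.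
Proof.
move=> [Cpsi npsi prime] tc.
have sub : commutator (nabla B) (nabla B) `<=` psi by move=> p; apply.
apply: npsi; apply/seteqP; split=> //.
by case: (prime _ _ (Con_nabla B) (Con_nabla B) sub).
Qed.

Section Modular.
Variable C : algebra S -> Prop.
Hypotheses (hC : equational_class C) (mod : congruence_modular C).
Hypotheses (hA : C A) (hB : C B).

(* If [alpha, beta] were below the inverse image phi, then A/phi, which is
   isomorphic to B/psi, would be abelian. *)
Lemma Spec_inverse_image psi : Spec B psi -> two_classes psi ->
  inverse_image f psi <> nabla A -> Spec A (inverse_image f psi).
Proof.
move=> Spsi two neq; have [Cpsi _ _] := Spsi.
have Cphi := Con_inverse_image hf Cpsi.
split=> // al be Ca Cb sub; apply: contrapT => /not_orP[na nb].
apply: (Spec_not_abelian Spsi).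
apply: (term_condition_nabla_inverse_image Cpsi two neq).
apply: (term_condition_two_classes Cphi (two_classes_inverse_image two) Ca Cb na nb).
exact: (term_condition_above_commutator hC mod hA Ca Cb Cphi sub).
Qed.

(** * Maximal congruences with abelian quotient *)

Section AbelianQuotient.
Variable psi : set (B * B).
Hypothesis psi_max : Max B psi.

Let Cpsi : Con B psi. Proof. by case: psi_max. Qed.

Lemma Max_join_nabla theta :
  Con B theta -> psi `<=` theta -> ~ theta `<=` psi -> theta = nabla B.
Proof.
move=> Cth sub nsub; apply: contrapT => nth; apply: nsub.
by have [_ _ /(_ _ Cth nth sub) ->] := psi_max.
Qed.

(** Restricting [D] to the diagonal gives a congruence of [B] that contains both [psi] and [alpha].
    By maximality it is [nabla B], so all diagonal elements are [D]-related. *)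
Lemma Max_term_condition_nabla alpha beta : Con B alpha -> Con B beta ->
  ~ alpha `<=` psi -> term_condition alpha beta psi ->
  term_condition (nabla B) beta psi.
Proof.
move=> Ca Cb na /(term_condition_witness Cb Ca Cpsi)[D [CD Dd Dpsi Dsat]].
have [br _ _ _] := Cb; have [Dr Ds Dt Dc] := CD; have [pr _ _ _] := Cpsi.
pose dg x := mkpair Cb (br x).
have Dnabla : [set p | D (dg p.1, dg p.2)] = nabla B.
  apply: Max_join_nabla.
  - split=> /= [x|x y|x y z|o a b h]; [exact: Dr|exact: Ds|exact: Dt|].
    have := Dc _ _ _ h; congr D; congr pair; exact: subproduct_inj.
  - by move=> [x y] h; apply: Dpsi.
  - by move=> h; apply: na => -[x y] axy; apply: h; apply: Dd.
move=> m n t a b c d _ cd.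
pose e j := mkpair Cb (cd j).
have h1 (x : 'I_m -> B) : proj1 \o concat (dg \o x) e = concat x c.
  by rewrite comp_concat.
have h2 (x : 'I_m -> B) : proj2 \o concat (dg \o x) e = concat x d.
  by rewrite comp_concat.
have [r1 r2] := eval_Con_algebra (concat (dg \o a) e) t.
have [s1 s2] := eval_Con_algebra (concat (dg \o b) e) t.
rewrite -(h1 a) -(h2 a) -(h1 b) -(h2 b) -r1 -r2 -s1 -s2; apply: Dsat.
apply: eval_Con => // i; rewrite /concat; case: fintype.split => j; last exact: Dr.
have : nabla B (a j, b j) by [].
by rewrite -Dnabla.
Qed.

(** Take [al] and [be] violating primality: enlarge [al] to [nabla B], exchange the two sides by
    symmetry, then enlarge [be]. *)
Lemma Max_not_Spec_abelian :
  ~ Spec B psi -> term_condition (nabla B) (nabla B) psi.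
Proof.
move=> nS; have [al [be [Ca [Cb [sub [na nb]]]]]] : exists al be,
    Con B al /\ Con B be /\ commutator al be `<=` psi /\
    ~ al `<=` psi /\ ~ be `<=` psi.
  apply: contrapT => h; apply: nS; split=> //; first by case: psi_max.
  move=> al be Ca Cb sub; apply: contrapT => /not_orP[na nb].
  by apply: h; exists al, be.
have Cn := Con_nabla B.
have tc := term_condition_above_commutator hC mod hB Ca Cb Cpsi sub.
have {}tc := Max_term_condition_nabla Ca Cb na tc.
have {}tc := term_condition_sym hC mod hB Cn Cb Cpsi tc.
exact: Max_term_condition_nabla Cb Cn nb tc.
Qed.

Hypothesis abelian : term_condition (nabla B) (nabla B) psi.

Let AB_nonempty : [set: A * B] !=set0.
Proof. by have [x] := Defs.nonempty A; exists (x, f x). Qed.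

Let AB := @subproduct S A B setT AB_nonempty (fun _ _ _ => I).
Let pair_AB x y : AB := exist _ (x, y) I.

(* A congruence [theta] above the inverse image is transported along [A * B] to
   a congruence [Psi] of [B] whose inverse image is [theta]: [K] joins the copy
   of [theta] inside the kernel of the second projection with the congruence
   [E] of differences, and [Psi] is [K] restricted to the fibres of the first
   projection.  Modularity recovers [theta] from [K]. *)
Lemma Max_inverse_image_abelian :
  inverse_image f psi <> nabla A -> Max A (inverse_image f psi).
Proof.
have Cn := Con_nabla B.
have [D DP] := term_condition_witness Cn Cn Cpsi abelian.
have [CD Dd Dpsi _] := DP; have [pr _ _ _] := Cpsi.
move=> neq; split=> //; first exact: Con_inverse_image.
move=> theta Cth nth sub; have [tr ts tt _] := Cth.
apply: contrapT => theta_neq; apply: nth.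
pose B2 x y : Con_algebra Cn := mkpair Cn (I : nabla B (x, y)).
pose h (r : AB) := B2 (f (proj1 r)) (proj2 r).
have hh : morphism h.
  by move=> o a; apply: subproduct_inj => //; apply: hf.
pose E := inverse_image h D.
have CE : Con AB E by apply: Con_inverse_image.
pose th0 : set (AB * AB) := inverse_image proj1 theta.
have Cth0 : Con AB th0 by apply: (Con_inverse_image (@morphism_proj1 _ _ _ _ _ _)).
pose th := th0 `&` @ker2 _ _ _ _ AB_nonempty (fun _ _ _ => I).
have Cker2 := @Con_ker2 _ _ _ _ AB_nonempty (fun _ _ _ => I).
have Cker1 := @Con_ker1 _ _ _ _ AB_nonempty (fun _ _ _ => I).
have Cth_ : Con AB th by apply: Con_setI.
pose K := Cg (th `|` E).
have CK : Con AB K by apply: Con_Cg.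
have [Kr Ks Kt Kc] := CK.
have genK : th `|` E `<=` K by apply: sub_gen_smallest.
have modAB : modular_Con AB by apply: mod; apply: equational_subproduct.
(* Since [th] lies below [ker2], the modular law reduces the claim to the meet of [E] and [ker2],
   which lies in [th] by [witness_ker2] and [sub]. *)
have K_theta r s : K (r, s) -> proj2 r = proj2 s -> theta (proj1 r, proj1 s).
  move=> k e; have := modAB _ _ _ Cth_ CE Cker2 (@subIsetr _ _ _).
  move=> /seteqP[/(_ (r, s) (conj k e)) + _].
  suff /[apply] : Cg (th `|` E `&` ker2 (Rop:=fun _ _ _ => I)) `<=` th by case.
  apply: smallest_sub => // -[u v] [//|[d e']]; split=> //.
  by apply: (sub (proj1 u, proj1 v)); exact: (witness_ker2 hC mod hB Cpsi DP d e').
(* The restriction of [K] to a fibre of the first projection is the same for all fibres. *)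
have K_shift x x' y y' : K (pair_AB x y, pair_AB x y') ->
    K (pair_AB x' y, pair_AB x' y').
  move=> k; apply: (@shifting _ _ modAB _ _ _ (pair_AB x y) (pair_AB x' y)
    (pair_AB x y') (pair_AB x' y') Cker2 Cker1 CK) => //.
  by rewrite setIC; apply: ker12.
(* The map [h] sends the graph of [f] into the diagonal, so the graph lies in one class of [E]. *)
have E_diag x x' : K (pair_AB x (f x), pair_AB x' (f x')).
  by apply: genK; right; apply: Dd.
have [a0] := Defs.nonempty A.
pose Psi : set (B * B) := [set p | K (pair_AB a0 p.1, pair_AB a0 p.2)].
have PsiT : Psi = nabla B.
  apply: Max_join_nabla.
  - split=> /= [x|x y|x y z|o a b ab]; [exact: Kr|exact: Ks|exact: Kt|].
    (* An operation may carry the fibre over [a0] to another one; the shift brings its values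
       back. *)
    apply: (K_shift (interp (fun _ : 'I_(arity o) => a0))).
    have := Kc _ _ _ ab; congr K; congr pair; exact: subproduct_inj.
  - by move=> [x y] xy; apply: genK; right; apply: Dpsi.
  (* The path (b, f b), (a, f a), (b, f a) shows that [Psi] contains (f a, f b) whenever [theta]
     contains (a, b). *)
  - move=> Psub; apply: theta_neq; apply/seteqP; split=> // -[a b] tab.
    apply: (Psub (f a, f b)) => /=; apply: (K_shift b).
    apply: Ks; apply: Kt (E_diag b a) _; apply: genK; left.
    by split=> //; apply: ts.
(* The path is (a, f b), (a, f a), (b, f b): the first link exists because [Psi] is full, the second
   runs along the graph of [f]. *)
apply/seteqP; split=> // -[a b] _.
apply: (K_theta (pair_AB a (f b)) (pair_AB b (f b))) => //.
apply: Kt (E_diag a b); apply: (K_shift a0).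
by have : nabla B (f b, f a) by []; rewrite -PsiT.
Qed.

End AbelianQuotient.
End Modular.
End InverseImage.

(** * The five admissibility criteria *)

Theorem corollary7p11 (S : signature) (C : algebra S -> Prop)
    (hC : equational_class C) (A B : algebra S) (hA : C A) (hB : C B)
    (f : A -> B) (hf : morphism f) :
  (Max B = Con2 B -> reflects_nabla f -> Max_admissible f) /\
  (congruence_modular C -> Spec B = Max B -> Max B = Con2 B ->
    reflects_nabla f -> Max A `<=` Spec A ->
    admissible f /\ Max_admissible f) /\
  (congruence_modular C -> Spec B = Con2 B -> reflects_nabla f ->
    finitely_generated (nabla A) ->
    admissible f /\ Max_admissible f) /\
  (semi_degenerate C -> Max B = Con2 B -> Max_admissible f) /\
  (semi_degenerate C -> congruence_modular C ->
    Spec B = Max B -> Max B = Con2 B ->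
    admissible f /\ Max_admissible f).
Proof.
have Con2P psi : Con2 B psi -> inverse_image f psi <> nabla A ->
    Max A (inverse_image f psi).
  move=> C2 neq; apply: Max_two_classes neq _.
    by apply: Con_inverse_image => //; case: C2.
  by apply: two_classes_inverse_image; apply: Con2_two_classes.
have neqP psi : reflects_nabla f -> Con B psi -> psi <> nabla B ->
    inverse_image f psi <> nabla A by apply: reflects_nabla_neq.
have sdP psi : semi_degenerate C -> Con B psi -> psi <> nabla B ->
    inverse_image f psi <> nabla A by apply: semi_degenerate_neq hC hB.
have specP psi : congruence_modular C -> Spec B psi -> Con2 B psi ->
    inverse_image f psi <> nabla A -> Spec A (inverse_image f psi).
  move=> mod Spsi /Con2_two_classes two.
  exact: (Spec_inverse_image hf hC mod hA Spsi two).
split; [|split; [|split; [|split]]].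
- move=> eM refl psi Mpsi; apply: Con2P; first by rewrite -eM.
  by case: Mpsi => *; apply: neqP.
- move=> mod eS eM refl _; split=> psi.
    move=> Spsi; have Mpsi : Max B psi by rewrite -eS.
    apply: specP => //; first by rewrite -eM.
    by case: Mpsi => *; apply: neqP.
  move=> Mpsi; apply: Con2P; first by rewrite -eM.
  by case: Mpsi => *; apply: neqP.
- move=> mod eS refl _; split=> psi.
    move=> Spsi; apply: specP => //; first by rewrite -eS.
    by case: Spsi => *; apply: neqP.
  move=> Mpsi; have neq : inverse_image f psi <> nabla A.
    by case: Mpsi => *; apply: neqP.
  have [Spsi|nS] := pselect (Spec B psi).
    by apply: Con2P => //; rewrite -eS.
  apply: (Max_inverse_image_abelian hf hC mod hA hB Mpsi) => //.
  exact: (Max_not_Spec_abelian hC mod hB Mpsi nS).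
- move=> sd eM psi Mpsi; apply: Con2P; first by rewrite -eM.
  by case: Mpsi => *; apply: sdP.
- move=> sd mod eS eM; split=> psi.
    move=> Spsi; have Mpsi : Max B psi by rewrite -eS.
    apply: specP => //; first by rewrite -eM.
    by case: Mpsi => *; apply: sdP.
  move=> Mpsi; apply: Con2P; first by rewrite -eM.
  by case: Mpsi => *; apply: sdP.
Qed.
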